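(* Let $N\in\mathbb N$ and let $\varepsilon>0$ be a given target accuracy. Then for sufficiently large $n\in\mathbb N$ with $n\ge4N$, there exist constants $w_j>0$ and frequencies $v_j\in(-1,1)$, $j=1,\dots,n$, such that $$\Big|\mathrm{sinc}(\pi Nx)-\sum_{j=1}^nw_j\,\mathrm e^{-\pi\mathrm iNv_jx}\Big|\le\varepsilon\qquad\text{for all }x\in[-1,1].$$
   Context: $\mathbb N$ is the set of positive integers, and $\mathrm{sinc}(y)=\frac{\sin y}y$ for $y\ne0$, $\mathrm{sinc}(0)=1$. ''Sufficiently large $n$'' means $n\ge n_0$ for some $n_0$ that may depend on $\varepsilon$ and $N$. *)

(* Defs.v *)
From mathcomp Require Import all_boot all_order all_algebra.
From mathcomp Require Import all_classical all_reals all_analysis.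
From mathcomp Require Export complex.
Set Implicit Arguments.
Unset Strict Implicit.
Unset Printing Implicit Defensive.
Import Order.TTheory GRing.Theory Num.Theory.
Local Open Scope ring_scope.
Local Open Scope complex_scope.

Definition sinc (R : realType) (y : R) : R := if y == 0 then 1 else sin y / y.

Definition cexp (R : realType) (z : R[i]) : R[i] :=
  (expR (complex.Re z))%:C *
    (cos (complex.Im z) +i* sin (complex.Im z)).

(* Main.v *)
Require Import Defs.
From mathcomp Require Import all_boot all_order all_algebra.
From mathcomp Require Import all_classical all_reals all_analysis.
From mathcomp Require Import complex.
From mathcomp Require Import ring lra.
Import Order.TTheory GRing.Theory Num.Theory.
Local Open Scope ring_scope.
Local Open Scope complex_scope.

(** The sum is the midpoint rule for [sinc a = 1/2 * \int_(-1)^1 exp (- i a v) dv]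
    on [n] cells of equal length, with [a = pi N x]: equal weights [1 / n] at the
    midpoints [v_j = (2 j + 1) / n - 1].  Its error has a closed form.  Writing
    [S] for the mean of the [cos (a v_j)], the product-to-sum formula turns
    [2 sin (a / n) * n S] into a telescoping sum with value [2 sin a], whence
    [sinc a = S * sinc (a / n)] ([sinc_midpoint_cos]); the sines cancel because
    the nodes are symmetric about [0].  As [|S| <= 1], the error
    [|S| * |sinc (a / n) - 1|] is at most [|sinc (a / n) - 1|]
    ([sinc_midpoint_error]).  Since [|a / n| <= pi N / n] uniformly in
    [x \in [-1, 1]] and [sinc] tends to [1] at [0] ([sinc_near0]), this is at most
    [eps] once [n] is large. *)

Definition midpoint (R : realType) (n : nat) (j : 'I_n) : R :=
  (2 * j%:R + 1) / n%:R - 1.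

Lemma midpoint_itv (R : realType) (n : nat) (j : 'I_n) :
  -1 < midpoint R n j < 1.
Proof.
have n0 : 0 < n%:R :> R by rewrite ltr0n (leq_ltn_trans _ (ltn_ord j)).
have jn : j%:R + 1 <= n%:R :> R by rewrite natr1 ler_nat ltn_ord.
have j0 : 0 <= j%:R :> R by [].
rewrite /midpoint ltrBDr addNr ltrBlDr ltr_pdivrMr // divr_gt0 //=; lra.
Qed.

Lemma midpoint_rev (R : realType) (n : nat) (j : 'I_n) :
  midpoint R n (rev_ord j) = - midpoint R n j.
Proof.
have n0 : n%:R != 0 :> R by rewrite pnatr_eq0 -lt0n (leq_ltn_trans _ (ltn_ord j)).
rewrite /midpoint /= natrB // -natr1; field; exact: n0.
Qed.

(** The limit [sin h / h --> 1] is the derivative of [sin] at [0]. *)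
Lemma sinc_near0 (R : realType) (eps : R) : 0 < eps ->
  exists2 d : R, 0 < d & forall h, `|h| < d -> `|sinc h - 1| <= eps.
Proof.
move=> eps0; have [+ +] := @is_derive_sin R 0.
rewrite cos0 /derivable /derive => cv lim1.
move/cvgrPdist_le: (cv); rewrite lim1 => /(_ _ eps0).
rewrite near_withinE => /nbhs_ballP[d /= d0 sub].
exists d => // h hd; rewrite /sinc; case: eqVneq => [_|h0].
  by rewrite subrr normr0 ltW.
have := sub h; rewrite /ball /= sub0r normrN => /(_ hd h0).
by rewrite distrC sin0 subr0 addr0 /GRing.scale /= mulr1 (mulrC h^-1).
Qed.

Lemma sincM (R : realType) (y : R) : y * sinc y = sin y.
Proof.
rewrite /sinc; case: eqVneq => [->|y0]; first by rewrite mul0r sin0.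
by rewrite mulrC divfK.
Qed.

(** After multiplication by [2 sin (a / n)], each cosine becomes the difference
    of the sines at the two ends of its cell, so the sum telescopes. *)
Lemma sinc_midpoint_cos (R : realType) (n : nat) (a : R) : (0 < n)%N ->
  sinc a = (\sum_(j < n) n%:R^-1 * cos (a * midpoint R n j)) * sinc (a / n%:R).
Proof.
move=> n_gt0; have n0 : n%:R != 0 :> R by rewrite pnatr_eq0 -lt0n.
have [->|a0] := eqVneq a 0.
  rewrite mul0r /sinc eqxx mulr1.
  under eq_bigr do rewrite mul0r cos0 mulr1.
  by rewrite sumr_const card_ord -[RHS]mulr_natr mulVf.
apply: (mulfI a0); rewrite sincM -mulr_sumr.
set C := \sum_(j < n) _.
have -> : a * (n%:R^-1 * C * sinc (a / n%:R)) = sin (a / n%:R) * C.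
  by rewrite -sincM; ring.
pose F (j : nat) : R := sin (a * (2 * j%:R / n%:R - 1)).
have -> : sin (a / n%:R) * C = \sum_(0 <= j < n) (F j.+1 - F j) / 2.
  rewrite /C mulr_sumr big_mkord; apply: eq_bigr => j _.
  have -> : F j.+1 = sin (a * midpoint R n j + a / n%:R).
    by congr sin; rewrite /midpoint -natr1; field.
  have -> : F j = sin (a * midpoint R n j - a / n%:R).
    by congr sin; rewrite /midpoint; field.
  by rewrite sinB sinD; field.
rewrite -mulr_suml telescope_sumr // /F.
have -> : a * (2 * n%:R / n%:R - 1) = a by field.
have -> : a * (2 * 0%:R / n%:R - 1) = - a by rewrite mulr0 mul0r sub0r mulrN1.
by rewrite sinN; field.
Qed.

Lemma midpoint_sin (R : realType) (n : nat) (a : R) :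
  \sum_(j < n) n%:R^-1 * sin (a * midpoint R n j) = 0.
Proof.
set S := \sum_(j < n) _; have : S = - S; last by lra.
rewrite {1}/S (reindex_inj rev_ord_inj) -sumrN; apply: eq_bigr => j _.
by rewrite midpoint_rev mulrN sinN mulrN.
Qed.

Lemma midpoint_cos_le1 (R : realType) (n : nat) (a : R) : (0 < n)%N ->
  `|\sum_(j < n) n%:R^-1 * cos (a * midpoint R n j)| <= 1.
Proof.
move=> n_gt0; rewrite -mulr_sumr normrM normfV normr_nat.
rewrite mulrC ler_pdivrMr ?ltr0n // mul1r.
apply: le_trans (ler_norm_sum _ _ _) _.
have -> : n%:R = \sum_(j < n) 1 :> R by rewrite sumr_const card_ord.
by apply: ler_sum => j _; exact: cos_max.
Qed.

Lemma sinc_midpoint_error (R : realType) (n : nat) (a : R) : (0 < n)%N ->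
  `|sinc a - \sum_(j < n) n%:R^-1 * cos (a * midpoint R n j)|
    <= `|sinc (a / n%:R) - 1|.
Proof.
move=> n_gt0; rewrite (sinc_midpoint_cos R n a n_gt0) -[X in _ - X]mulr1 -mulrBr.
by rewrite normrM ler_piMl // midpoint_cos_le1.
Qed.

Lemma cexp_imag (R : realType) (N : nat) (v x : R) :
  cexp (- (pi%:C * 'i%C * N%:R * v%:C * x%:C))
  = cos (pi * N%:R * x * v) -i* sin (pi * N%:R * x * v).
Proof.
have -> : - (pi%:C * 'i%C * N%:R * v%:C * x%:C)
          = 0 -i* (pi * N%:R * x * v) :> R[i].
  rewrite -(rmorph_nat (real_complex R)) /=.
  by apply/eqP; rewrite eq_complex /=; apply/andP; split; apply/eqP; ring.
by rewrite /cexp /= expR0 mul1r cosN sinN.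
Qed.

Theorem corollary5p2 (R : realType) (N : nat) (hN : (0 < N)%N)
    (eps : R) (heps : 0 < eps) :
  exists n0 : nat, forall n : nat, (n0 <= n)%N -> (4 * N <= n)%N ->
    exists (w v : 'I_n -> R),
      (forall j, 0 < w j) /\
      (forall j, -1 < v j < 1) /\
      (forall x : R, -1 <= x <= 1 ->
        `| (sinc (pi * N%:R * x))%:C
           - \sum_(j < n) (w j)%:C
               * cexp (- (pi%:C * 'i%C * N%:R * (v j)%:C * x%:C)) |
        <= eps%:C).
Proof.
have [d d0 sincd] := sinc_near0 R eps heps.
have piN0 : 0 <= pi * N%:R :> R by rewrite mulr_ge0 ?pi_ge0.
exists (Num.bound (pi * N%:R / d)) => n n0n n4.
have n_gt0 : (0 < n)%N by apply: leq_trans n4; rewrite muln_gt0.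
exists (fun=> n%:R^-1), (midpoint R n).
split=> [j|]; first by rewrite invr_gt0 ltr0n.
split=> [j|x x1]; first exact: midpoint_itv.
set a := pi * N%:R * x.
have small : `|a / n%:R| < d.
  rewrite normrM normfV normr_nat ltr_pdivrMr ?ltr0n //.
  apply: (@le_lt_trans _ _ (pi * N%:R)).
    by rewrite normrM ger0_norm // ler_piMr // ler_norml.
  rewrite (mulrC d) -ltr_pdivrMr //.
  have b0 : 0 <= pi * N%:R / d by rewrite divr_ge0 // ltW.
  by apply: lt_le_trans (archi_boundP b0) _; rewrite ler_nat.
under eq_bigr => j _ do rewrite cexp_imag -/a.
have -> : (\sum_(j < n) (n%:R^-1)%:C *
              (cos (a * midpoint R n j) -i* sin (a * midpoint R n j)))
          = (\sum_(j < n) n%:R^-1 * cos (a * midpoint R n j))%:C.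
  apply: etrans (_ : (\sum_(j < n) n%:R^-1 * cos (a * midpoint R n j)) +i*
      - (\sum_(j < n) n%:R^-1 * sin (a * midpoint R n j)) = _); last first.
    by rewrite midpoint_sin oppr0.
  rewrite -sumrN; elim/big_rec3: _ => // j z s c _ ->.
  by apply/eqP; rewrite eq_complex /= !mul0r ?subr0 ?addr0 mulrN !eqxx.
rewrite -rmorphB normc_def /= expr0n /= addr0 sqrtr_sqr lecR.
exact: le_trans (sinc_midpoint_error R n a n_gt0) (sincd _ small).
Qed.
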